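(* Let $\mathcal{L}$ be a Prob-solvable loop with guard polynomial $G$, let $I$ be a pure invariant of $\mathcal{L}$, and let $M$ be a polynomial expression over the program variables of $\mathcal{L}$. Suppose there exist $i_0\in\mathbb{N}$, $c>0$ and $\epsilon$ such that $\mathbb{P}(M_{i_0}<0)>0$ and for all $i\ge i_0$, almost surely: (1) $\neg\mathit{Guard}_i\wedge I_i\implies M_i\ge 0$; (2) $\mathit{Guard}_i\wedge I_i\implies \mathbb{E}(M_{i+1}-M_i\mid\mathcal{F}_i)\le -\epsilon$; (3) $|M_{i+1}-M_i|<c$. If $\epsilon>0$, then $\mathcal{L}$ is not AST. If $\epsilon\ge 0$, then $\mathcal{L}$ is not PAST.
   Context: A Prob-solvable loop $\mathcal{L}$ with real-valued variables $x_{(1)},\dots,x_{(m)}$ is a program consisting of: an initialization $x_{(1)}:=r_{(1)},\dots,x_{(m)}:=r_{(m)}$ with $r_{(j)}\in\mathbb{R}$; a guard $P>Q$ with $P,Q\in\mathbb{R}[x_{(1)},\dots,x_{(m)}]$; and a loop body which is the sequence, for $j=1,\dots,m$ in this order, of probabilistic updates $x_{(j)} := a_{(j1)}x_{(j)}+P_{(j1)}\ [p_{j1}]\ \cdots [p_{j(l_j-1)}]\ a_{(jl_j)}x_{(j)}+P_{(jl_j)}$, meaning the $k$-th alternative is executed with probability $p_{jk}$ for $k<l_j$ and the last with probability $1-\sum_{k<l_j}p_{jk}$ (choices independent), where $a_{(jk)}\ge0$ are constants, $P_{(jk)}\in\mathbb{R}[x_{(1)},\dots,x_{(j-1)}]$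 (evaluated at the already-updated values), $p_{jk}\in[0,1]$, $\sum_k p_{jk}<1$. The guard polynomial is $G:=P-Q$. A state is a vector in $\mathbb{R}^m$; a run is an infinite sequence of states. The loop space is the filtered probability space $(\Omega,\Sigma,(\mathcal{F}_i)_{i\in\mathbb{N}},\mathbb{P})$ with $\Omega=(\mathbb{R}^m)^\omega$, $\Sigma$ generated by cylinder sets of finite prefixes, $\mathcal{F}_i$ generated by cylinder sets of prefixes of length $i+1$, and $\mathbb{P}$ the measure under which the first state is the initialization state and each next state is obtained from the current state $s$ by executing the loop body once if $G(s)>0$, and equals $s$ otherwise. For an expression $E$, $E_i(\vartheta):=E(\vartheta_i)$; for a formula $B$, $B_i$ is $B$ evaluated at the $i$-th state; $\mathit{Guard}_i$ is the event $G_i>0$. The looping time is $T(\vartheta):=\inf\{i: \vartheta_i\not\models P>Q\}$; $\mathcal{L}$ is AST if $\mathbb{P}(T<\infty)=1$ and PAST if $\mathbb{E}(T)<\infty$. A pure invariant is a formula $I$ over the program variables such that $I_i$ holds almost surely for all $i$. *)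

(* Defs.v *)
From HB Require Import structures.
From mathcomp Require Import all_boot all_order all_algebra.
From mathcomp Require Import mpoly.
From mathcomp Require Import all_classical all_reals all_analysis.

Set Implicit Arguments.
Unset Strict Implicit.
Unset Printing Implicit Defensive.
Import Order.TTheory GRing.Theory Num.Theory.
Local Open Scope ring_scope.
Local Open Scope classical_set_scope.

Definition state (R : realType) (m : nat) := 'I_m -> R.

Definition peval (R : realType) (m : nat) (p : mpoly.mpoly m R) (s : state R m) : R :=
  mpoly.meval s p.

(* A Prob-solvable loop with m real variables.
   - pl_init j         : initial value r_(j)
   - pl_P, pl_Q        : guard P > Q
   - pl_alts j         : the first l_j - 1 alternatives of the update of x_(j),
                         each given as ((a_(jk), P_(jk)), p_jk)
   - pl_last j         : the last alternative (a_(j l_j), P_(j l_j)), executed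
                         with probability 1 - sum_k p_jk. *)
Record probLoop (R : realType) (m : nat) := ProbLoop {
  pl_init : state R m;
  pl_P : mpoly.mpoly m R;
  pl_Q : mpoly.mpoly m R;
  pl_alts : 'I_m -> seq ((R * mpoly.mpoly m R) * R);
  pl_last : 'I_m -> R * mpoly.mpoly m R }.

Definition guardPoly (R : realType) (m : nat) (L : probLoop R m) : mpoly.mpoly m R :=
  pl_P L - pl_Q L.

Definition depends_below (R : realType) (m : nat) (j : nat) (p : mpoly.mpoly m R) : Prop :=
  forall mo, mo \in mpoly.msupp p ->
    forall k : 'I_m, (j <= k)%N -> tnth (mpoly.multinom_val mo) k = 0%N.

Definition prob_solvable (R : realType) (m : nat) (L : probLoop R m) : Prop :=
  forall j : 'I_m,
    (forall t, t \in pl_alts L j ->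
        0 <= t.1.1 /\ depends_below j t.1.2 /\ 0 <= t.2 <= 1) /\
    0 <= (pl_last L j).1 /\ depends_below j (pl_last L j).2 /\
    \sum_(t <- pl_alts L j) t.2 < 1.

Definition upd (R : realType) (m : nat) (s : state R m) (j : 'I_m)
    (ap : R * mpoly.mpoly m R) : state R m :=
  fun k => if k == j then ap.1 * s j + peval ap.2 s else s k.

(* Executing the update of x_(j) on a finite distribution of states
   (list of (probability, state)). *)
Definition stepj (R : realType) (m : nat) (L : probLoop R m) (j : 'I_m)
    (d : seq (R * state R m)) : seq (R * state R m) :=
  flatten [seq [seq (pr.1 * t.2, upd pr.2 j t.1) | t <- pl_alts L j] ++
               [:: (pr.1 * (1 - \sum_(t <- pl_alts L j) t.2), upd pr.2 j (pl_last L j))]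
          | pr <- d].

Definition body_dist (R : realType) (m : nat) (L : probLoop R m) (s : state R m)
    : seq (R * state R m) :=
  foldl (fun d j => stepj L j d) [:: (1, s)] (enum 'I_m).

Definition trans (R : realType) (m : nat) (L : probLoop R m) (s s' : state R m) : R :=
  if 0 < peval (guardPoly L) s
  then \sum_(pr <- body_dist L s) pr.1 * (`[< pr.2 = s' >])%:R
  else (`[< s' = s >])%:R.

Definition run (R : realType) (m : nat) := nat -> state R m.
Section RunPointed.
Variables (R : realType) (m : nat).
HB.instance Definition _ := gen_eqMixin (run R m).
HB.instance Definition _ := gen_choiceMixin (run R m).
HB.instance Definition _ := isPointed.Build (run R m) (fun _ _ => 0%R).
End RunPointed.

Definition cylinders_upto (R : realType) (m : nat) (i : nat) : set (set (run R m)) :=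
  [set C | exists B : nat -> set (state R m),
             C = [set th : run R m | forall k, (k <= i)%N -> B k (th k)]].

Definition cylinders (R : realType) (m : nat) : set (set (run R m)) :=
  [set C | exists i, @cylinders_upto R m i C].

Notation loopSpace R m := (g_sigma_algebraType (@cylinders R m)).

Definition filtr (R : realType) (m : nat) (i : nat) : set (set (loopSpace R m)) :=
  <<s @cylinders_upto R m i >>.

(* P is the loop-space measure of L: the first state is the initial state and
   each next state is drawn according to the transition kernel. Stated on the
   cylinder sets fixing a prefix (which determine the measure, since the
   process is finitely branching). *)
Definition is_loop_measure (R : realType) (m : nat) (L : probLoop R m)
    (P : probability (loopSpace R m) R) : Prop :=
  forall (i : nat) (h : nat -> state R m),
    P [set th : loopSpace R m | forall k, (k <= i)%N -> th k = h k] =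
    ((`[< h 0%N = pl_init L >])%:R * \prod_(k < i) trans L (h k) (h k.+1))%:E.

(* Looping time T = inf { i | theta_i does not satisfy P > Q } (inf of empty = +oo). *)
Definition loopTime (R : realType) (m : nat) (L : probLoop R m) (th : loopSpace R m)
    : \bar R :=
  ereal_inf [set ((i%:R : R)%:E) | i in [set i : nat | ~ (0 < peval (guardPoly L) (th i))]].

Definition AST (R : realType) (m : nat) (L : probLoop R m)
    (P : probability (loopSpace R m) R) : Prop :=
  P [set th : loopSpace R m | (loopTime L th < +oo)%E] = 1%E.

Definition PAST (R : realType) (m : nat) (L : probLoop R m)
    (P : probability (loopSpace R m) R) : Prop :=
  (\int[P]_th loopTime L th < +oo)%E.

Definition pure_invariant (R : realType) (m : nat)
    (P : probability (loopSpace R m) R) (I : state R m -> Prop) : Prop :=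
  forall i : nat, {ae P, forall th : loopSpace R m, I (th i)}.

Definition is_cond_exp (d : measure_display) (T : measurableType d) (R : realType)
    (P : probability T R) (F : set (set T)) (X Y : T -> R) : Prop :=
  P.-integrable setT (EFin \o X) /\
  (forall B : set R, measurable B -> F (Y @^-1` B)) /\
  P.-integrable setT (EFin \o Y) /\
  (forall A, F A -> (\int[P]_(x in A) (Y x)%:E = \int[P]_(x in A) (X x)%:E)%E).

(* Main.v *)
Require Import Defs.
From HB Require Import structures.
From mathcomp Require Import all_boot all_order all_algebra.
From mathcomp Require Import mpoly.
From mathcomp Require Import all_classical all_reals all_analysis.
From mathcomp Require Import measurable_realfun zify lra.
Import Order.TTheory GRing.Theory Num.Theory.
Local Open Scope ring_scope.
Local Open Scope classical_set_scope.

(** The loop is finitely branching, so almost every run follows one of finitely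
many prefixes up to any time n, and the conditional drift hypothesis becomes an
inequality on each prefix atom.  Fix a prefix of length i0 with positive
probability on which M < 0, and let A be the event that the run follows it.  If
phi is a test function for which the drift bound makes phi(M_n) a supermartingale
from i0 on, then E(phi(M_n); A) <= phi(M_i0) P(A).  Terminated runs have M_n >= 0.
For eps > 0 take phi(x) = exp(t x) with t small: then P(A, T <= n) is at most
exp(t M_i0) P(A), a proportion of P(A) bounded away from 1.  For eps >= 0 take
phi(x) = x: since M_n >= M_i0 - c(n - i0), nonnegativity of M on terminated runs
forces P(T > n) to be at least of order 1/n, so E(T) = sum_n P(T > n) diverges. *)

(** * Reachable prefixes and the mass of their atoms *)

Section FiniteBranching.
Set Implicit Arguments.
Unset Strict Implicit.
Variables (R : realType) (m : nat) (L : probLoop R m).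

Definition cyl (n : nat) (h : nat -> state R m) : set (loopSpace R m) :=
  [set th | forall k, (k <= n)%N -> th k = h k].

(** Duplicates are removed so that summing [trans] over this list counts each target once; targets
    of probability zero may remain. *)
Definition succ (s : state R m) : seq (state R m) :=
  if 0 < peval (guardPoly L) s then undup [seq pr.2 | pr <- body_dist L s]
  else [:: s].

Definition ext (n : nat) (h : nat -> state R m) (s : state R m) : nat -> state R m :=
  fun k => if (k <= n)%N then h k else s.

(** Pathwise version of the loop's dynamics: [traj_ae] gives it full measure, and halting and
    boundedness then hold for each of its runs. *)
Definition traj : set (loopSpace R m) :=
  [set th | th 0%N = pl_init L /\ forall k, th k.+1 \in succ (th k)].

Fixpoint prefixes (n : nat) : seq (nat -> state R m) :=
  if n is n'.+1 then [seq ext n' h s | h <- prefixes n', s <- succ (h n')]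
  else [:: fun=> pl_init L].

Lemma prefixesP n (th : loopSpace R m) :
  th 0%N = pl_init L -> (forall k, (k < n)%N -> th k.+1 \in succ (th k)) ->
  exists2 h, h \in prefixes n & cyl n h th.
Proof.
move=> th0; elim: n => [|n IH] thS.
  by exists (fun=> pl_init L); rewrite ?inE // => k; rewrite leqn0 => /eqP ->.
have [k kn|h hn hth] := IH; first exact/thS/ltnW.
exists (ext n h (th n.+1)).
  by apply/allpairsPdep; exists h, (th n.+1); split => //; rewrite -hth ?thS.
move=> k; rewrite /ext; case: (leqP k n) => [kn _|nk kn]; first exact: hth.
by congr th; apply/eqP; rewrite eqn_leq kn.
Qed.

Lemma traj_prefixes n th : traj th -> exists2 h, h \in prefixes n & cyl n h th.
Proof. by move=> [th0 thS]; apply: prefixesP. Qed.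

(** Finitely many states are reachable at time [n], so any function is bounded on them; the sum
    stands in for a maximum. *)
Lemma traj_bounded n (g : state R m -> R) :
  exists B, forall th, traj th -> `|g (th n)| <= B.
Proof.
exists (\sum_(h <- prefixes n) `|g (h n)|) => th /(traj_prefixes n)[h hn hth].
by rewrite (big_rem h hn) /= hth // lerDl sumr_ge0.
Qed.

Lemma traj_halted th i n : traj th -> ~ 0 < peval (guardPoly L) (th i) ->
  (i <= n)%N -> th n = th i.
Proof.
move=> [_ thS] Gi; elim: n => [|n IH]; first by rewrite leqn0 => /eqP ->.
rewrite leq_eqVlt => /predU1P[-> //|/IH ni].
by have := thS n; rewrite /succ ni; case: ifP => // _; rewrite inE => /eqP.
Qed.

Lemma cyl_cases n p (h h' : nat -> state R m) : (n <= p)%N ->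
  cyl p h' `<=` cyl n h \/ cyl n h `&` cyl p h' = set0.
Proof.
move=> np; have [hh'|hh'] := pselect (forall k, (k <= n)%N -> h' k = h k).
  by left=> th hth k kn; rewrite hth ?hh'// (leq_trans kn).
right; rewrite -subset0 => th [hn hp]; apply: hh' => k kn.
by rewrite -hn// hp// (leq_trans kn).
Qed.

(** Each update splits a weight into shares that add up to it, the last alternative taking the
    remainder, so total weight is preserved along the fold. *)
Lemma body_dist_sum (s : state R m) : \sum_(pr <- body_dist L s) pr.1 = 1.
Proof.
rewrite /body_dist.
have: \sum_(pr <- [:: (1 : R, s)]) pr.1 = 1 by rewrite big_seq1.
elim: (enum 'I_m) [:: (1, s)] => [//|j js IH] d d1 /=; apply: IH.
rewrite -d1 /stepj big_flatten big_map; apply: eq_bigr => pr _.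
rewrite big_cat big_map big_seq1 /= -big_distrr /= -mulrDr.
by rewrite addrC subrK mulr1.
Qed.

(** After exchanging the sums, every entry of [body_dist L s] matches exactly one element of the
    deduplicated list. *)
Lemma trans_sum (s : state R m) : \sum_(s' <- succ s) trans L s s' = 1.
Proof.
rewrite /succ /trans; case: ifP => _; last by rewrite big_seq1 asboolT.
rewrite exchange_big /= -[RHS](body_dist_sum s).
rewrite big_seq [RHS]big_seq; apply: eq_bigr => pr prs.
rewrite -big_distrr /= (bigD1_seq pr.2) ?undup_uniq ?mem_undup ?map_f//=.
rewrite asboolT // big1 ?addr0 ?mulr1 // => s' s'pr.
by rewrite asboolF // => prs'; rewrite prs' eqxx in s'pr.
Qed.

(** Cylinders are built on arbitrary sets of states, so no regularity of [B] enters; this makes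
    every function of one coordinate measurable. *)
Lemma measurable_coord n (B : set (state R m)) :
  measurable [set th : loopSpace R m | B (th n)].
Proof.
apply: sub_sigma_algebra; exists n, (fun k => if k == n then B else setT).
apply/seteqP; split => th /= => [Bn k kn|/(_ n (leqnn _))]; last by rewrite eqxx.
by case: eqP => // ->.
Qed.

Lemma filtr_cyl n h : filtr n (cyl n h).
Proof. by apply: sub_sigma_algebra; exists (fun k => [set h k]). Qed.

Lemma measurable_cyl n h : measurable (cyl n h).
Proof. by apply: sub_sigma_algebra; exists n, (fun k => [set h k]). Qed.

Lemma measurable_fun_coord d (S : measurableType d) n (g : state R m -> S)
    (D : set (loopSpace R m)) :
  measurable_fun D (fun th : loopSpace R m => g (th n)).
Proof.
move=> mD B _; apply: measurableI => //.
exact: (measurable_coord n (g @^-1` B)).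
Qed.

Variable P : probability (loopSpace R m) R.
Hypothesis PL : is_loop_measure L P.

Lemma cyl_ext_measure n h s :
  P (cyl n.+1 (ext n h s)) = (P (cyl n h) * (trans L (h n) s)%:E)%E.
Proof.
rewrite /cyl !PL -EFinM big_ord_recr /= mulrA; congr (_ * _ * _)%:E.
  apply: eq_bigr => k _; rewrite /ext /= ltnW ?ltn_ord//.
by rewrite /ext leqnn ltnn.
Qed.

(** Uniqueness of [l] makes the one-step extensions of the prefix disjoint, so their masses add. *)
Lemma cyl_succ_measure n h (l : seq (state R m)) : uniq l ->
  P (cyl n h `&` [set th : loopSpace R m | th n.+1 \in l]) =
  (P (cyl n h) * (\sum_(s <- l) trans L (h n) s)%:E)%E.
Proof.
elim: l => [|s l IH] /=.
  by rewrite big_nil mule0 (_ : _ `&` _ = set0) ?measure0// -subset0 => th [].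
move=> /andP[sl ul]; rewrite big_cons EFinD.
have -> : cyl n h `&` [set th : loopSpace R m | th n.+1 \in s :: l] =
    cyl n.+1 (ext n h s) `|` (cyl n h `&` [set th : loopSpace R m | th n.+1 \in l]).
  apply/seteqP; split => th /=.
    move=> [hth]; rewrite inE => /predU1P[thn|thn]; last by right.
    left=> k; rewrite /ext; case: (leqP k n) => [kn _|nk kn]; first exact: hth.
    by rewrite -thn; congr th; apply/eqP; rewrite eqn_leq kn.
  case=> [hth|[hth thn]]; last by split => //; rewrite inE thn orbT.
  split; last by rewrite hth// /ext ltnn inE eqxx.
  by move=> k kn; rewrite hth ?leqW// /ext kn.
transitivity (P (cyl n.+1 (ext n h s)) +
    P (cyl n h `&` [set th : loopSpace R m | th n.+1 \in l]))%E.
  apply: measureU; first exact: measurable_cyl.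
    apply: measurableI; first exact: measurable_cyl.
    exact: (measurable_coord n.+1 [set x | x \in l]).
  rewrite -subset0 => th /= [hth [_]].
  by rewrite hth// /ext ltnn (negbTE sl).
rewrite IH// cyl_ext_measure /cyl PL -!EFinM -EFinD; congr EFin.
by rewrite mulrDr.
Qed.

Lemma succ_ae n h : P (cyl n h `&` [set th : loopSpace R m | th n.+1 \notin succ (h n)]) = 0%E.
Proof.
have us : uniq (succ (h n)) by rewrite /succ; case: ifP => // _; exact: undup_uniq.
have mS : measurable (cyl n h `&` [set th : loopSpace R m | th n.+1 \in succ (h n)]).
  apply: measurableI; first exact: measurable_cyl.
  exact: (measurable_coord n.+1 [set x | x \in succ (h n)]).
have -> : cyl n h `&` [set th : loopSpace R m | th n.+1 \notin succ (h n)] =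
    cyl n h `\` (cyl n h `&` [set th : loopSpace R m | th n.+1 \in succ (h n)]).
  apply/seteqP; split => th /= [hth thn]; split => //; first by case=> _; exact/negP.
  by apply/negP => thn'; apply: thn.
transitivity (P (cyl n h) -
    P (cyl n h `&` [set th : loopSpace R m | th n.+1 \in succ (h n)]))%E.
  rewrite [LHS]measureD ?setIA ?setIid//; first exact: measurable_cyl.
  by rewrite (le_lt_trans (probability_le1 _ _)) ?ltry//; exact: measurable_cyl.
rewrite cyl_succ_measure// trans_sum mule1 /cyl PL.
by rewrite -EFinB subrr.
Qed.

(** The exceptional null sets are indexed by prefixes, a priori an uncountable family; [prefixes n]
    reduces it to a finite one at each time. *)
Lemma traj_ae : {ae P, forall th, traj th}.
Proof.
have ae0 : {ae P, forall th : loopSpace R m, th 0%N = pl_init L}.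
  exists (~` cyl 0 (fun=> pl_init L)); split.
  - by apply: measurableC; exact: measurable_cyl.
  - rewrite probability_setC; last exact: measurable_cyl.
    by rewrite /cyl PL big_ord0 asboolT// mulr1 subee.
  - by move=> th /= + hth; apply; apply: hth.
have aeS n : {ae P, forall th : loopSpace R m,
    th 0%N = pl_init L /\ forall k, (k < n)%N -> th k.+1 \in succ (th k)}.
  elim: n => [|n IH]; first by apply: filterS ae0.
  have aeH h : {ae P, forall th, cyl n h th -> th n.+1 \in succ (h n)}.
    exists (cyl n h `&` [set th : loopSpace R m | th n.+1 \notin succ (h n)]); split.
    - apply: measurableI; first exact: measurable_cyl.
      exact: (measurable_coord n.+1 [set x | x \notin succ (h n)]).
    - exact: succ_ae.
    - by move=> th /= /not_implyP[hth /negP].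
  have aeP : {ae P, forall th, forall h, h \in prefixes n -> cyl n h th ->
      th n.+1 \in succ (h n)}.
    elim: (prefixes n) => [|h l IHl]; first exact: aeW.
    apply: filterS2 (aeH h) IHl => th hh hl h'.
    by rewrite inE => /predU1P[->|/hl].
  apply: filterS2 IH aeP => th [th0 thS] thP; split => // k.
  rewrite ltnS leq_eqVlt => /predU1P[->|/thS//].
  have [h hn hth] := prefixesP th0 thS.
  by rewrite [th n]hth//; apply: thP.
have /ae_foralln := aeS.
apply: filterS => th thn; split; first by have [] := thn 0%N.
by move=> k; have [_] := thn k.+1; apply.
Qed.

End FiniteBranching.

(** * Supermartingale estimates on atoms, within a set [W] of full measure where the hypotheses hold
    pathwise *)

Section Drift.
Set Implicit Arguments.
Unset Strict Implicit.
Variables (R : realType) (m : nat) (L : probLoop R m).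
Variables (P : probability (loopSpace R m) R) (W : set (loopSpace R m)).
Variables (f : state R m -> R) (i0 : nat) (c eps : R).
Hypothesis mW : measurable W.
Hypothesis W1 : P (~` W) = 0%E.
Hypothesis W_traj : W `<=` traj L.
Hypothesis W_incr : forall n th, (i0 <= n)%N -> W th ->
  `|f (th n.+1) - f (th n)| < c.
Hypothesis W_drift : forall n, (i0 <= n)%N -> exists Y : loopSpace R m -> R,
  is_cond_exp P (@filtr R m n) (fun th => f (th n.+1) - f (th n)) Y /\
  forall th, W th -> 0 < peval (guardPoly L) (th n) -> Y th <= - eps.

Lemma probability_ltey (A : set (loopSpace R m)) : measurable A -> (P A < +oo)%E.
Proof. by move=> mA; rewrite (le_lt_trans (probability_le1 _ _)) ?ltry. Qed.

Lemma coord_integrable n (g : state R m -> R) (D : set (loopSpace R m)) :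
  measurable D -> D `<=` W ->
  P.-integrable D (EFin \o (fun th : loopSpace R m => g (th n))).
Proof.
move=> mD DW; apply: measurable_bounded_integrable => //.
- exact: probability_ltey.
- exact: measurable_fun_coord.
- have [B gB] := traj_bounded L n g.
  exists B; split; first exact: num_real.
  by move=> x Bx th Dth; rewrite /= (le_trans (gB _ _)) ?(ltW Bx)//; exact/W_traj/DW.
Qed.

(** The atom belongs to [filtr n], so the defining identity of conditional expectation applies to
    it, and the guard holds throughout it. *)
Lemma drift_cyl n h : (i0 <= n)%N -> 0 < peval (guardPoly L) (h n) ->
  \int[P]_(th in cyl n h `&` W) (f (th n.+1) - f (th n)) <=
  - eps * fine (P (cyl n h `&` W)).
Proof.
move=> i0n Gh; have [Y [[iX [_ [iY XY]]] YW]] := W_drift i0n.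
have mC := measurable_cyl n h.
have mD : measurable (cyl n h `&` W) by exact: measurableI.
(* [W] need not lie in [filtr n]: the identity is used on the whole cylinder, and [W] is cut out
   afterwards at no cost. *)
have restr (Z : loopSpace R m -> R) : P.-integrable setT (EFin \o Z) ->
    (\int[P]_(th in cyl n h) (Z th)%:E = \int[P]_(th in cyl n h `&` W) (Z th)%:E)%E.
  move=> iZ; have iZC : P.-integrable (cyl n h) (EFin \o Z).
    exact: integrableS iZ.
  have := negligible_integral (measurableC mW) mC iZC W1.
  by rewrite setDE setCK.
rewrite -Rintegral_cst//.
rewrite {1}/Rintegral -(restr _ iX) -XY; last exact: filtr_cyl.
rewrite (restr _ iY); apply: le_Rintegral => //.
- exact: integrableS iY.
- exact: finite_measure_integrable_cst.
- by move=> th [hth Wth]; apply: YW => //; rewrite hth.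
Qed.

Section TestFunction.
Variable phi : R -> R.
(* With a = M_n, x = M_{n+1} - M_n and l independent of x, this turns the drift
   bound E(x) <= - eps on an atom into E(phi(M_{n+1})) <= phi(M_n). *)
Hypothesis phiP : forall a, exists2 l, 0 <= l &
  forall x, `|x| < c -> phi (a + x) <= phi a + l * (x + eps).

(** [f (th n)] is constant on the atom, so a single slope [l] serves there and comes out of the
    integral. *)
Lemma phi_step_cyl n h : (i0 <= n)%N ->
  \int[P]_(th in cyl n h `&` W) (phi (f (th n.+1)) - phi (f (th n))) <= 0.
Proof.
move=> i0n; have mC := measurable_cyl n h.
have mD : measurable (cyl n h `&` W) by exact: measurableI.
have DW : cyl n h `&` W `<=` W by move=> ? [].
have iphi k := coord_integrable k (phi \o f) mD DW.
have if_ k := coord_integrable k f mD DW.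
have [Gh|Gh] := pselect (0 < peval (guardPoly L) (h n)); last first.
  (* A halted run stays in its state, so the integrand vanishes. *)
  rewrite (_ : \int[_]_(_ in _) _ = 0)//.
  rewrite -[RHS](mul0r (fine (P (cyl n h `&` W)))) -Rintegral_cst//.
  apply: eq_Rintegral => th; rewrite inE => -[hth Wth].
  rewrite (traj_halted (i := n) (n := n.+1) (W_traj Wth)) ?subrr//.
  by rewrite hth.
have [l l0 lP] := phiP (f (h n)).
have ie : P.-integrable (cyl n h `&` W)
    (EFin \o (fun th : loopSpace R m => f (th n.+1) - f (th n))).
  exact: (integrableB mD (if_ n.+1) (if_ n)).
have ic (r : R) : P.-integrable (cyl n h `&` W) (EFin \o (fun=> r)).
  exact: finite_measure_integrable_cst.
apply: (@le_trans _ _ (\int[P]_(th in cyl n h `&` W)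
    (l * ((f (th n.+1) - f (th n)) + eps)))).
  apply: le_Rintegral => //.
  - exact: (integrableB mD (iphi n.+1) (iphi n)).
  - apply: (integrableZl mD l (f := EFin \o _)) => //.
    exact: (integrableD mD ie (ic eps)).
  - move=> th [hth Wth]; rewrite lerBlDl (hth n)//.
    rewrite -[X in phi X](subrKC (f (h n))); apply: lP.
    by rewrite -(hth n)//; exact: W_incr.
rewrite RintegralZl//; last exact: (integrableD mD ie (ic eps)).
rewrite RintegralD// Rintegral_cst//.
by rewrite mulr_ge0_le0// -lerBrDr sub0r -mulNr drift_cyl.
Qed.

(* The induction on the list of prefixes needs no uniqueness: a repeated atom has
   an empty remainder. *)
Lemma Rintegral_cover_le0 n (g : loopSpace R m -> R) (hs : seq (nat -> state R m))
    (E : set (loopSpace R m)) :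
  measurable E -> P.-integrable E (EFin \o g) ->
  (forall th, E th -> exists2 h, h \in hs & cyl n h th) ->
  (forall h, \int[P]_(th in E `&` cyl n h) g th <= 0) ->
  \int[P]_(th in E) g th <= 0.
Proof.
elim: hs E => [|h hs IH] E mE iE Ehs Eg.
  rewrite (_ : E = set0) ?Rintegral_set0// -subset0 => th /Ehs[h].
  by rewrite in_nil.
have mC := measurable_cyl n h.
rewrite -(setUIDK E (cyl n h)).
have mI : measurable (E `&` cyl n h) by exact: measurableI.
have mD : measurable (E `\` cyl n h) by exact: measurableD.
rewrite Rintegral_setU ?setUIDK//; last first.
  by apply/disj_setPS => th [[_ ?] []].
rewrite -[leRHS](addr0 0); apply: lerD; first exact: Eg.
apply: IH => //.
- exact: integrableS iE.
- move=> th [Eth nth]; have [h' +] := Ehs th Eth.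
  by rewrite inE => /predU1P[->|? ?]; last by exists h'.
- move=> h'; have [hh'|hh'] := cyl_cases h h' (leqnn n).
    rewrite (_ : _ `&` _ = set0) ?Rintegral_set0// -subset0.
    by move=> th [[_ nth] /hh'].
  rewrite (_ : _ `&` _ = E `&` cyl n h')//.
  apply/seteqP; split=> th /= [].
    by move=> [].
  move=> Eth h'th; do 2 split => //; move=> hth.
  by have : set0 th by rewrite -hh'.
Qed.

(** Induction on time from [i0]; each one-step difference is summed over the atoms of time [n]. *)
Lemma phi_nonincreasing n h0 : (i0 <= n)%N ->
  \int[P]_(th in cyl i0 h0 `&` W) phi (f (th n)) <=
  phi (f (h0 i0)) * fine (P (cyl i0 h0 `&` W)).
Proof.
have mA : measurable (cyl i0 h0 `&` W) by apply: measurableI => //; exact: measurable_cyl.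
have AW : cyl i0 h0 `&` W `<=` W by move=> ? [].
have iphi k := coord_integrable k (phi \o f) mA AW.
elim: n => [|n IH].
  rewrite leqn0 => /eqP i00; rewrite -Rintegral_cst//.
  apply: le_Rintegral => //.
  - exact: (iphi 0).
  - exact: finite_measure_integrable_cst.
  - by move=> th [hth _]; rewrite -(hth i0)// i00.
rewrite leq_eqVlt => /predU1P[<-|].
  rewrite -Rintegral_cst//.
  apply: le_Rintegral => //.
  - exact: (iphi i0).
  - exact: finite_measure_integrable_cst.
  - by move=> th [hth _]; rewrite -(hth i0).
rewrite ltnS => i0n; apply: le_trans (IH i0n).
rewrite -subr_le0 -RintegralB//; last 2 first.
- exact: (iphi n.+1).
- exact: (iphi n).
apply: (@Rintegral_cover_le0 n _ (prefixes L n)) => //.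
- exact: (integrableB mA (iphi n.+1) (iphi n)).
- by move=> th [_ /W_traj]; exact: traj_prefixes.
(* An atom of time [n >= i0] either refines the starting atom or misses it. *)
- move=> h; have [h0h|h0h] := cyl_cases h0 h i0n.
    rewrite (_ : _ `&` _ = cyl n h `&` W); first exact: phi_step_cyl.
    by apply/seteqP; split => [th [[_ ?] ?]|th [/[dup] /h0h ? ? ?]].
  rewrite (_ : _ `&` _ = set0) ?Rintegral_set0// -subset0.
  by move=> th [[hth _] h'th]; have : set0 th by rewrite -h0h.
Qed.

(** The event [T > n]. *)
Definition alive (n : nat) : set (loopSpace R m) :=
  [set th | forall i, (i <= n)%N -> 0 < peval (guardPoly L) (th i)].

Lemma measurable_alive n : measurable (alive n).
Proof.
apply: sub_sigma_algebra; exists n, (fun=> [set s | 0 < peval (guardPoly L) s]).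
by [].
Qed.

(** On the starting atom the integral of [phi] is at least [b] times the halted mass plus [g] times
    the alive mass, and at most its starting value; the halted mass is then eliminated. *)
Lemma alive_bound n h0 b g : (i0 <= n)%N ->
  (forall th, W th -> ~ 0 < peval (guardPoly L) (th n) -> b <= phi (f (th n))) ->
  (forall th, cyl i0 h0 th -> W th -> g <= phi (f (th n))) ->
  (b - phi (f (h0 i0))) * fine (P (cyl i0 h0 `&` W)) <=
  (b - g) * fine (P (cyl i0 h0 `&` W `&` alive n)).
Proof.
move=> i0n bP gP; have := phi_nonincreasing h0 i0n.
set A := cyl i0 h0 `&` W.
have mA : measurable A by apply: measurableI => //; exact: measurable_cyl.
have mU := measurable_alive n.
have mI : measurable (A `&` alive n) by exact: measurableI.
have mD : measurable (A `\` alive n) by exact: measurableD.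
have AW : A `<=` W by move=> ? [].
have PA : fine (P A) = fine (P (A `&` alive n)) + fine (P (A `\` alive n)).
  rewrite -fineD ?fin_num_measure//; congr fine.
  rewrite -[in LHS](setUIDK A (alive n)); apply: measureU => //.
  by rewrite -subset0 => th [[_ ?] []].
have iA := coord_integrable n (phi \o f) mA AW.
have -> : \int[P]_(th in A) phi (f (th n)) =
    \int[P]_(th in A `&` alive n) phi (f (th n)) +
    \int[P]_(th in A `\` alive n) phi (f (th n)).
  rewrite -[in LHS](setUIDK A (alive n)); apply: Rintegral_setU => //.
    by rewrite setUIDK.
  by apply/disj_setPS => th [[_ ?] []].
have leI : g * fine (P (A `&` alive n)) <= \int[P]_(th in A `&` alive n) phi (f (th n)).
  rewrite -Rintegral_cst//; apply: le_Rintegral => //.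
  - exact: finite_measure_integrable_cst.
  - by apply: integrableS iA.
  - by move=> th [[hth Wth] _]; exact: gP.
have leD : b * fine (P (A `\` alive n)) <= \int[P]_(th in A `\` alive n) phi (f (th n)).
  rewrite -Rintegral_cst//; apply: le_Rintegral => //.
  - exact: finite_measure_integrable_cst.
  - by apply: integrableS iA => //; exact: subDsetl.
  (* A guard failure at some [i <= n] freezes the run, so the guard also fails at [n] and [b]
     applies. *)
  - move=> th [[hth Wth] nU]; apply: bP => // Gn; apply: nU => i iN.
    apply: contrapT => Gi; have := traj_halted (W_traj Wth) Gi iN.
    by move=> thn; apply: Gi; rewrite -thn.
by rewrite PA; lra.
Qed.

End TestFunction.
End Drift.

(** * Tails of the looping time as a test for AST and PAST *)

Section LoopingTime.
Set Implicit Arguments.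
Unset Strict Implicit.
Variables (R : realType) (m : nat) (L : probLoop R m).
Variable P : probability (loopSpace R m) R.

Lemma alive_nonincreasing n p : (n <= p)%N -> alive L p `<=` alive L n.
Proof. by move=> np th thp i iN; apply: thp; exact: leq_trans np. Qed.

Lemma loopTime_lty th : (loopTime L th < +oo)%E -> ~ (\bigcap_n alive L n) th.
Proof.
move=> /ereal_inf_ltP[_ [i Gi <-] _] /(_ i I)/(_ i (leqnn _)).
exact: Gi.
Qed.

(** [T] is a countable infimum of functions of one coordinate, with [+oo] as the neutral value where
    the guard holds. *)
Lemma measurable_loopTime :
  measurable_fun setT (loopTime L : loopSpace R m -> \bar R).
Proof.
pose v i (s : state R m) : \bar R :=
  if 0 < peval (guardPoly L) s then +oo%E else (i%:R)%:E.
have -> : loopTime L = fun th : loopSpace R m => einfs (fun i => v i (th i)) 0%N.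
  apply/funext => th; apply/eqP; rewrite eq_le; apply/andP; split.
    apply/ereal_infP => _ [i _ <-]; rewrite /v; case: ifPn => [_|/negP Gi].
      exact: leey.
    by apply: ereal_inf_lbound; exists i.
  apply/ereal_infP => _ [i Gi <-]; apply: ereal_inf_lbound.
  by exists i => //; rewrite /v ifN//; exact/negP.
apply: measurable_fun_einfs => n; exact: measurable_fun_coord.
Qed.

(** Truncation of the identity that [T] is the sum over [n] of the indicators of [T > n]. *)
Lemma sum_alive_le N th :
  ((\sum_(0 <= n < N) \1_(alive L n) th)%:E <= loopTime L th)%E.
Proof.
apply/ereal_infP => _ [i Gi <-]; rewrite lee_fin.
(* If the guard fails at [i], the run can only be alive at times [n < i]. *)
apply: (@le_trans _ _ (\sum_(0 <= n < N) (n < i)%:R)).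
  apply: ler_sum => n _; rewrite indicE ler_nat.
  case: (ltnP n i) => [|iN]; first by rewrite leq_b1.
  by rewrite memNset// => /(_ i iN).
rewrite -natr_sum ler_nat.
suff -> : (\sum_(0 <= n < N) (n < i) = minn N i)%N by exact: geq_minr.
elim: N => [|N IH]; first by rewrite big_nil min0n.
by rewrite big_nat_recr//= IH; case: (ltnP N i) => iN; lia.
Qed.

Lemma sum_alive_le_integral N :
  ((\sum_(0 <= n < N) fine (P (alive L n)))%:E <= \int[P]_th loopTime L th)%E.
Proof.
have mI n : measurable_fun setT (EFin \o (\1_(alive L n) : loopSpace R m -> R)).
  by apply/measurable_EFinP; apply: measurable_indic; exact: measurable_alive.
have -> : ((\sum_(0 <= n < N) fine (P (alive L n)))%:E =
    \int[P]_th (\sum_(0 <= n < N) \1_(alive L n) th)%:E)%E.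
  under eq_integral do rewrite -sumEFin.
  rewrite ge0_integral_sum//.
  rewrite -sumEFin; apply: eq_bigr => n _.
  rewrite integral_indic ?setIT//; last exact: measurable_alive.
  by rewrite fineK// fin_num_measure//; exact: measurable_alive.
apply: ge0_le_integral => //.
- by move=> th _; rewrite lee_fin sumr_ge0.
- apply/measurable_EFinP; apply: measurable_sum => n.
  by apply: measurable_indic; exact: measurable_alive.
- exact: measurable_loopTime.
- by move=> th _; exact: sum_alive_le.
Qed.

(** Continuity from above: the events [T > n] decrease to [T = +oo], which is null. *)
Lemma AST_alive : AST L P -> (P (alive L n) @[n --> \oo] --> 0)%E.
Proof.
move=> ast; have mU := measurable_alive L.
have mI : measurable (\bigcap_n alive L n) by exact: bigcapT_measurable.
have mT : measurable [set th | (loopTime L th < +oo)%E].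
  rewrite (_ : mkset _ = ~` \bigcap_n alive L n); first exact: measurableC.
  apply/seteqP; split => th /=; first exact: loopTime_lty.
  move=> /existsNP[n /not_implyP[_ /existsNP[i /not_implyP[_ Gi]]]].
  by apply/ereal_inf_ltP; exists (i%:R)%:E; [exists i|rewrite ltry].
have P0 : P (\bigcap_n alive L n) = 0%E.
  apply/eqP; rewrite eq_le measure_ge0 andbT.
  have -> : 0%E = P (~` [set th | (loopTime L th < +oo)%E]).
    by rewrite probability_setC// [P _]ast subee.
  apply: le_measure; rewrite ?inE//; first exact: measurableC.
  by move=> th Uth /loopTime_lty; apply.
rewrite -P0; apply: nonincreasing_cvg_mu => //.
- exact: probability_ltey.
- by move=> n p np; apply/subsetPset; exact: alive_nonincreasing.
Qed.

Lemma not_AST (d : R) n0 : 0 < d ->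
  (forall n, (n0 <= n)%N -> d <= fine (P (alive L n))) -> ~ AST L P.
Proof.
move=> d0 dP /AST_alive Pcv.
suff : (d%:E <= 0)%E by rewrite lee_fin leNgt d0.
rewrite -(cvg_lim _ Pcv)//; apply: lime_ge; first by apply/cvg_ex; exists 0%E.
near=> n; rewrite -[leRHS]fineK ?fin_num_measure//; last exact: measurable_alive.
by rewrite lee_fin; apply: dP; near: n; exact: nbhs_infty_ge.
Unshelve. all: by end_near. Qed.

(** The tail [P(T > n)] is at least [d / (n + 1)], so a finite expectation would bound the harmonic
    series. *)
Lemma not_PAST (d : R) : 0 < d ->
  (forall n, d <= n.+1%:R * fine (P (alive L n))) -> ~ PAST L P.
Proof.
move=> d0 dP past; apply: (@dvg_harmonic R).
have int0 : (0 <= \int[P]_th loopTime L th)%E.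
  by have := sum_alive_le_integral 0; rewrite big_nil.
have intK : (fine (\int[P]_th loopTime L th))%:E = (\int[P]_th loopTime L th)%E.
  by rewrite fineK// ge0_fin_numE.
apply: nondecreasing_is_cvgn.
  apply/nondecreasing_seqP => n; rewrite /series /= big_nat_recr//= lerDl.
  by rewrite invr_ge0.
exists (d^-1 * fine (\int[P]_th loopTime L th)) => _ [N _ <-].
apply: (@le_trans _ _ (d^-1 * \sum_(0 <= n < N) fine (P (alive L n)))).
  rewrite /series /= mulr_sumr; apply: ler_sum => n _.
  by rewrite ler_pdivlMl// ler_pdivrMr// mulrC.
rewrite ler_wpM2l ?invr_ge0 ?(ltW d0)//.
by rewrite -lee_fin intK; exact: sum_alive_le_integral.
Qed.

End LoopingTime.

(** * Exponential test function for strict drift *)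

Section TestFunctions.
Variable R : realType.

(** From [1 - y <= expR (- y)] one gets [(1 - y) * expR y <= 1], while [(1 - y) * (1 + y + 2 * y ^+
    2) = 1 + y ^+ 2 * (1 - 2 * y)] is at least 1. *)
Lemma expR_le_quadratic (y : R) : `|y| <= 2^-1 -> expR y <= 1 + y + 2 * y ^+ 2.
Proof.
rewrite ler_norml => /andP[y1 y2].
have e0 := expR_gt0 y.
have : (1 - y) * expR y <= 1.
  by rewrite -ler_pdivlMr// div1r -expRN; exact: expR_ge1Dx.
move=> H; have q : 1 <= (1 - y) * (1 + y + 2 * y ^+ 2) by nra.
have : (1 - y) * expR y <= (1 - y) * (1 + y + 2 * y ^+ 2) by exact: le_trans q.
by rewrite ler_pM2l//; lra.
Qed.

Lemma expR_drift (c eps : R) : 0 < c -> 0 < eps -> exists2 t, 0 < t &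
  forall x, `|x| < c -> expR (t * x) <= 1 + t * (x + eps).
Proof.
(* The first bound keeps [t * x] in the range of the quadratic estimate, the second keeps its error
   [2 * (t * x) ^+ 2] below [t * eps]. *)
move=> c0 e0; pose t := Num.min (2 * c)^-1 (eps / (2 * c ^+ 2)).
have t0 : 0 < t by rewrite lt_min invr_gt0 divr_gt0 ?mulr_gt0 ?exprn_gt0.
have tc : t * c <= 2^-1.
  have : t <= (2 * c)^-1 by rewrite ge_min lexx.
  by rewrite invfM -ler_pdivlMr.
have te : 2 * (t * c ^+ 2) <= eps.
  have : t <= eps / (2 * c ^+ 2) by rewrite ge_min lexx orbT.
  by rewrite ler_pdivlMr ?mulr_gt0 ?exprn_gt0// mulrCA.
exists t => // x xc.
have x2 : x ^+ 2 <= c ^+ 2.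
  by rewrite -(real_normK (num_real x)) ler_pXn2r// ?nnegrE// ltW.
apply: le_trans (expR_le_quadratic _) _.
  by rewrite normrM (gtr0_norm t0) (le_trans _ tc)// ler_pM2l// ltW.
have : t * (2 * (t * x ^+ 2)) <= t * eps.
  rewrite ler_pM2l// (le_trans _ te)// ler_pM2l// ler_pM2l//.
by rewrite exprMn mulrDr; nra.
Qed.

End TestFunctions.

(** * Choice of a starting atom and application of the two test functions *)

Theorem mainTheorem2 (R : realType) (m : nat) (L : probLoop R m)
    (P : probability (loopSpace R m) R) (I : state R m -> Prop)
    (M : mpoly.mpoly m R) (i0 : nat) (c eps : R) :
  prob_solvable L ->
  is_loop_measure L P ->
  pure_invariant P I ->
  0 < c ->
  (0 < P [set th : loopSpace R m | (peval M (th i0) < 0)%R])%E ->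
  (forall i : nat, (i0 <= i)%N ->
     {ae P, forall th : loopSpace R m,
        ~ (0 < peval (guardPoly L) (th i)) -> I (th i) -> 0 <= peval M (th i)}) ->
  (forall i : nat, (i0 <= i)%N ->
     exists Y : loopSpace R m -> R,
       is_cond_exp P (@filtr R m i)
         (fun th => peval M (th i.+1) - peval M (th i)) Y /\
       {ae P, forall th : loopSpace R m,
          0 < peval (guardPoly L) (th i) -> I (th i) -> Y th <= - eps}) ->
  (forall i : nat, (i0 <= i)%N ->
     {ae P, forall th : loopSpace R m, `|peval M (th i.+1) - peval M (th i)| < c}) ->
  (0 < eps -> ~ AST L P) /\ (0 <= eps -> ~ PAST L P).
Proof.
move=> _ PL PI c0 PM M_ge0 M_drift M_incr.
(* One version of the conditional expectation is fixed per time, so that countably many null sets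
   can be merged; below [i0] the value 0 is a placeholder. *)
have /choice[Y PY] n : exists Y : loopSpace R m -> R, (i0 <= n)%N ->
    is_cond_exp P (@filtr R m n) (fun th => peval M (th n.+1) - peval M (th n)) Y /\
    {ae P, forall th : loopSpace R m,
      0 < peval (guardPoly L) (th n) -> I (th n) -> Y th <= - eps}.
  have [/M_drift[Y]|] := leqP i0 n; first by exists Y.
  by exists (fun=> 0).
pose good n (th : loopSpace R m) := (i0 <= n)%N ->
  [/\ ~ 0 < peval (guardPoly L) (th n) -> 0 <= peval M (th n),
      0 < peval (guardPoly L) (th n) -> Y n th <= - eps &
      `|peval M (th n.+1) - peval M (th n)| < c].
have good_ae : {ae P, forall th, traj L th /\ forall n, good n th}.
  have : {ae P, forall th, forall n, good n th}.
    apply: ae_foralln => n; have [i0n|ni0] := leqP i0 n; last first.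
      by apply: aeW => th; rewrite /good leqNgt ni0.
    have [_ aeY] := PY n i0n.
    have aeI : {ae P, forall th : loopSpace R m, I (th n) /\
        `|peval M (th n.+1) - peval M (th n)| < c}.
      by apply: filterS2 (PI n) (M_incr n i0n) => th.
    apply: filterS3 (M_ge0 n i0n) aeY aeI => th h1 h2 [h3 h4] _.
    by split=> // G; auto.
  by apply: filterS2 (traj_ae PL) => th thL thg; split.
have [N [mN PN0 goodN]] := good_ae.
pose W := ~` N; have mW : measurable W := measurableC mN.
have W1 : P (~` W) = 0%E by rewrite setCK.
have WP th : W th -> traj L th /\ forall n, good n th.
  by move=> Wth; apply: contrapT => /goodN.
have W_traj : W `<=` traj L by move=> th /WP[].
have W_incr n th : (i0 <= n)%N -> W th -> `|peval M (th n.+1) - peval M (th n)| < c.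
  by move=> i0n /WP[_ /(_ n i0n)[]].
have W_ge0 n th : (i0 <= n)%N -> W th ->
    ~ 0 < peval (guardPoly L) (th n) -> 0 <= peval M (th n).
  by move=> i0n /WP[_ /(_ n i0n)[]].
have W_drift n : (i0 <= n)%N -> exists Y : loopSpace R m -> R,
    is_cond_exp P (@filtr R m n) (fun th => peval M (th n.+1) - peval M (th n)) Y /\
    forall th, W th -> 0 < peval (guardPoly L) (th n) -> Y th <= - eps.
  move=> i0n; exists (Y n); split; first by have [] := PY n i0n.
  by move=> th /WP[_ /(_ n i0n)[]].
(* Otherwise [M_i0 < 0] would be covered by [N] and finitely many null atoms. *)
have [h0 [Mh0 PA]] : exists h0, peval M (h0 i0) < 0 /\ 0 < fine (P (cyl i0 h0 `&` W)).
  apply: contrapT => noh; move: PM; apply/negP; rewrite -leNgt.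
  have mC h : measurable (cyl i0 h `&` W).
    by apply: measurableI => //; exact: measurable_cyl.
  have P0 h : peval M (h i0) < 0 -> P.-negligible (cyl i0 h `&` W).
    move=> Mh; exists (cyl i0 h `&` W); split => //.
    apply: contra_notP noh => /eqP Pn0; exists h; split => //.
    rewrite fine_gt0// lt0e Pn0 measure_ge0/=.
    exact: probability_ltey.
  have : P.-negligible [set th : loopSpace R m | peval M (th i0) < 0].
    have negN : P.-negligible N by exists N; split.
    apply: (negligibleS (A := N `|`
        \big[setU/set0]_(h <- prefixes L i0 | peval M (h i0) < 0) (cyl i0 h `&` W))).
      move=> th /= Mth; have [Nth|Wth] := pselect (N th); [by left|right].
      have [h hi hth] := traj_prefixes i0 (W_traj _ Wth).
      rewrite -bigcup_seq_cond; exists h; last by [].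
      by rewrite /= hi -(hth i0).
    apply: negligibleU => //.
    apply: (big_ind (fun A => P.-negligible A)) => //; first exact: negligible_set0.
    exact: negligibleU.
  move=> /measure_negligible -> //.
  exact: (measurable_coord i0 [set s | peval M s < 0]).
set mu0 := peval M (h0 i0) in Mh0 *.
set p0 := fine (P (cyl i0 h0 `&` W)) in PA.
have le_alive n : fine (P (cyl i0 h0 `&` W `&` alive L n)) <= fine (P (alive L n)).
  have mU := measurable_alive L n.
  have mI : measurable (cyl i0 h0 `&` W `&` alive L n).
    by do 2 (apply: measurableI => //); exact: measurable_cyl.
  by rewrite fine_le ?fin_num_measure//; apply: le_measure; rewrite ?inE//.
split => [eps0|eps0].
  have [t t0 tP] := expR_drift c0 eps0.
  have phiP a : exists2 l, 0 <= l & forall x, `|x| < c ->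
      expR (t * (a + x)) <= expR (t * a) + l * (x + eps).
    (* Factoring out [expR (t * a)] reduces the claim to [expR_drift]. *)
    exists (expR (t * a) * t); first by rewrite mulr_ge0 ?expR_ge0 ?ltW.
    move=> x xc; rewrite mulrDr expRD -mulrA -[X in X + _]mulr1 -mulrDr.
    by rewrite ler_pM2l ?expR_gt0 ?tP.
  apply: (@not_AST _ _ _ _ ((1 - expR (t * mu0)) * p0) i0).
    by rewrite mulr_gt0// subr_gt0 expR_lt1 pmulr_rlt0.
  move=> n i0n; apply: le_trans (le_alive n).
  (* [b = 1] since the exponential is at least 1 where [M >= 0]; [g = 0] since it is never
     negative. *)
  have := alive_bound mW W1 W_traj W_incr W_drift phiP (h0 := h0) (b := 1) (g := 0) i0n.
  rewrite subr0 mul1r; apply.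
    move=> th Wth Gn; rewrite -expR0 ler_expR mulr_ge0 ?(ltW t0)//.
    exact: W_ge0 Gn.
  by move=> th _ _; exact: expR_ge0.
have phiP a : exists2 l, 0 <= l & forall x, `|x| < c -> a + x <= a + l * (x + eps).
  by exists 1 => // x _; rewrite mul1r lerD2l lerDl.
(* Chosen so that [c * n - mu0 <= K * (n + 1)]. *)
pose K := c - mu0.
have K0 : 0 < K by rewrite addr_gt0 ?oppr_gt0.
apply: (@not_PAST _ _ _ _ (- mu0 * p0 / K)).
  by rewrite divr_gt0 ?mulr_gt0 ?oppr_gt0.
move=> n; rewrite ler_pdivrMr//.
(* Taken at time [n + i0]: [n] steps after [i0], [M] has dropped by at most [c * n], which gives
   [g]; halted runs have [M >= 0], which gives [b]. *)
have := alive_bound mW W1 W_traj W_incr W_drift (phi := id) phiP (h0 := h0)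
  (b := 0) (g := mu0 - c * n%:R) (leq_addl n i0).
rewrite !sub0r opprB => bound.
apply: le_trans (bound _ _) _.
- by move=> th Wth; exact: W_ge0 (leq_addl n i0) Wth.
- move=> th hth Wth /=; elim: n {bound} => [|n IH].
    by rewrite add0n mulr0 subr0 /mu0 -(hth i0).
  have := W_incr (n + i0)%N th (leq_addl n i0) Wth.
  rewrite ltr_norml addSn => /andP[H _].
  rewrite -[n.+1]addn1 natrD mulrDr mulr1; lra.
have pn : fine (P (cyl i0 h0 `&` W `&` alive L (n + i0))) <= fine (P (alive L n)).
  have mU := measurable_alive L.
  apply: le_trans (le_alive _) _; rewrite fine_le ?fin_num_measure//.
  by apply: le_measure; rewrite ?inE//; apply: alive_nonincreasing; exact: leq_addr.
have cn : 0 <= c * n%:R by rewrite mulr_ge0// ltW.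
have mn : 0 <= - mu0 * n%:R by rewrite mulr_ge0// oppr_ge0 ltW.
rewrite mulrAC; apply: ler_pM => //.
- by rewrite subr_ge0 (le_trans (ltW Mh0)).
- by rewrite fine_ge0.
- by rewrite /K -[n.+1]addn1 natrD; nra.
Qed.
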